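(* Let $\mathcal{S} \subset \mathbb{R}^2$ be a non-empty finite set (of stations), let $W \subset \mathbb{R}^2$ be a non-empty, bounded, open set, let $(C(s))_{s\in\mathcal{S}}$ be Borel sets forming a partition of $W$, let $\widehat\lambda : W \to [0,\infty)$ be integrable, and put $\Lambda(s) = \int_{C(s)} \widehat\lambda(u)\,du$ for $s \in \mathcal{S}$. Suppose that $\Lambda(s) > 0$ for all $s \in \mathcal{S}$ and let $K \in \mathbb{N}$ satisfy $K \geq |\mathcal{S}|$. Let $n = n_K : \mathcal{S} \to \mathbb{N}$ be the output of any run of the greedy vehicle allocation algorithm (defined in the context), stopped when $K$ units have been allocated. Then $n(s) \geq 1$ for all $s\in\mathcal{S}$, $\sum_{s\in\mathcal{S}} n(s) = K$, and $n$ minimises the maximal average risk under these constraints, that is, \[ \max_{s\in\mathcal{S}} \frac{\Lambda(s)}{n(s)} \;\leq\; \max_{s\in\mathcal{S}} \frac{\Lambda(s)}{m(s)} \] for every $m:\mathcal{S}\to\mathbb{N}$ with $\sum_{s\in\mathcal{S}} m(s) = K$.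
   Context: Here $\mathbb{N} = \{1,2,\dots\}$ and $|\cdot|$ denotes cardinality. The number $\Lambda(s)$ is the (estimated) total risk in the catchment area $C(s)$ of station $s$, $\widehat\lambda$ being an estimator of the intensity function of incidents; $n(s)$ is the number of vehicles allocated to $s$, and $K$ is the total number of available vehicles. Greedy vehicle allocation algorithm. Initialise by allocating one unit to every station: $n_{|\mathcal{S}|}(s) = 1$ for all $s\in\mathcal{S}$. Given $(n_k(s))_{s\in\mathcal{S}}$, the allocation after $k$ units have been allocated ($|\mathcal{S}| \leq k < K$), choose a station \[ s^* \in \arg\max_{s\in\mathcal{S}} \frac{\Lambda(s)}{n_k(s)} \] (any maximiser may be chosen if there are several), and set $n_{k+1}(s^* ) = n_k(s^* ) + 1$ and $n_{k+1}(s) = n_k(s)$ for $s \neq s^*$. The output is $n_K$. *)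

(* Defs.v *)
From mathcomp Require Import all_boot all_order all_algebra.
From mathcomp Require Import finmap.
From mathcomp Require Import all_classical all_reals all_analysis.
Set Implicit Arguments.
Unset Strict Implicit.
Unset Printing Implicit Defensive.
Import Order.TTheory GRing.Theory Num.Theory numFieldNormedType.Exports.
Local Open Scope classical_set_scope.
Local Open Scope ring_scope.

Notation lebesgue2 R := (@lebesgue_measure R \x @lebesgue_measure R)%E.

(* The library's sigma-algebra on [R] is the Borel one, so the measurable
   sets of the product are exactly the Borel sets of the plane, the
   topology of [R] being second countable. *)
Definition borel2 (R : realType) (A : set (R * R)) : Prop :=
  measurable (A : set (measurableTypeR R * measurableTypeR R)).

(* The risk intensity is a total function on the plane; only its values on the
   observation window are ever constrained or used. *)
Definition catchment_risk (R : realType) (S : {fset R * R})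
    (C : S -> set (R * R)) (lambda : R * R -> R) (s : S) : R :=
  Rintegral (lebesgue2 R) (C s) lambda.

(* [a k] is the allocation after [k] units; only the terms with
   [#|T| <= k <= K] matter. *)
Definition greedy_run (R : realType) (T : finType) (L : T -> R) (K : nat)
    (a : nat -> T -> nat) : Prop :=
  (forall s, a #|T| s = 1%N) /\
  forall k, (#|T| <= k < K)%N ->
    exists s' : T,
      [/\ forall s, L s / (a k s)%:R <= L s' / (a k s')%:R,
          a k.+1 s' = (a k s').+1
        & forall s, s != s' -> a k.+1 s = a k s].

(* The default value 0 of the iterated maximum is harmless: it is only used for
   [L >= 0] and a nonempty [T]. *)
Definition max_avg_risk (R : realType) (T : finType) (L : T -> R)
    (n : T -> nat) : R :=
  \big[Num.max/0]_(s : T) (L s / (n s)%:R).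

(* Main.v *)
(* A station [s] holding at least two units received its last one when its
   average risk [L s / (n s - 1)] was maximal, and average risks only decrease
   afterwards; hence [L t / n t <= L s / (n s - 1)] for all [t] in the final
   allocation [n].  A competitor [m] with the same total that gives [t] more
   units than [n] gives some [s] at most [n s - 1] of them, so its maximal
   average risk is at least [L s / (n s - 1) >= L t / n t]. *)

Require Import Defs.
From mathcomp Require Import all_boot all_order all_algebra.
From mathcomp Require Import finmap.
From mathcomp Require Import all_classical all_reals all_analysis.
Import Order.TTheory GRing.Theory Num.Theory numFieldNormedType.Exports.
Local Open Scope classical_set_scope.
Local Open Scope ring_scope.

Set Implicit Arguments.
Unset Strict Implicit.
Unset Printing Implicit Defensive.

Lemma ler_div_nat (R : realType) (x : R) (i j : nat) :
  0 <= x -> (0 < i <= j)%N -> x / j%:R <= x / i%:R.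
Proof.
move=> x_ge0 /andP[i_gt0 le_ij].
by rewrite ler_wpM2l// lef_pV2 ?posrE ?ltr0n ?ler_nat// (leq_trans i_gt0).
Qed.

(** Otherwise [n] would lie below [m] everywhere and strictly below at [t], making the sums
    differ. *)
Lemma sum_eq_ltn (T : finType) (n m : T -> nat) (t : T) :
  (\sum_s n s = \sum_s m s)%N -> (n t < m t)%N -> exists s, (m s < n s)%N.
Proof.
move=> eq_nm lt_nm; apply/existsP; apply: contraT => /existsPn le_nm.
suff: (\sum_s n s < \sum_s m s)%N by rewrite eq_nm ltnn.
rewrite (bigD1 t)// [ltnRHS](bigD1 t)//= -addSn leq_add// leq_sum// => s _.
by rewrite leqNgt le_nm.
Qed.

Section Greedy.
Variables (R : realType) (T : finType) (L : T -> R) (K : nat).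
Variable a : nat -> T -> nat.
Hypotheses (L_ge0 : forall s, 0 <= L s) (a_greedy : greedy_run L K a).

(** Invariants of the run are proved through this principle: it suffices to check the all-ones
    allocation and one greedy step between abstract allocations [n] and [n']. *)
Lemma greedy_run_ind (P : nat -> (T -> nat) -> Prop) :
    (forall n, (forall s, n s = 1%N) -> P #|T| n) ->
    (forall k n n' s', P k n ->
      (forall s, L s / (n s)%:R <= L s' / (n s')%:R) ->
      n' s' = (n s').+1 -> (forall s, s != s' -> n' s = n s) -> P k.+1 n') ->
  forall k, (#|T| <= k <= K)%N -> P k (a k).
Proof.
case: a_greedy => a_init a_step P0 PS; elim=> [|k IHk] /andP[le_Tk le_kK].
  (* Index 0 is in range only when [T] is empty, and it is then the starting index. *)
  by move: le_Tk; rewrite leqn0 => /eqP T0; rewrite -T0; exact: P0.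
move: le_Tk; rewrite leq_eqVlt => /predU1P[<-|]; first exact: P0.
rewrite ltnS => le_Tk.
have [s' [s'_max s'_inc s'_stay]] := a_step k ltac:(by rewrite le_Tk).
by apply: PS s'_max s'_inc s'_stay; apply: IHk; rewrite le_Tk ltnW.
Qed.

Lemma greedy_gt0 k s : (#|T| <= k <= K)%N -> (0 < a k s)%N.
Proof.
move=> k_bnd; move: s; apply: (greedy_run_ind (P := fun _ n => forall s, (0 < n s)%N)) k_bnd.
  by move=> n n1 s; rewrite n1.
move=> {}k n n' s' n_gt0 _ n's' n'E s.
by have [->|/n'E->//] := eqVneq s s'; rewrite n's'.
Qed.

Lemma greedy_sum k : (#|T| <= k <= K)%N -> (\sum_s a k s)%N = k.
Proof.
apply: (greedy_run_ind (P := fun k n => (\sum_s n s)%N = k)).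
  by move=> n n1; under eq_bigr do rewrite n1; rewrite sum1_card.
move=> {}k n n' s' <- _ n's' n'E.
by rewrite (bigD1 s')//= n's' (eq_bigr _ n'E) [in RHS](bigD1 s').
Qed.

Lemma greedy_exchange k s t : (#|T| <= k <= K)%N -> (1 < a k s)%N ->
  L t / (a k t)%:R <= L s / (a k s).-1%:R.
Proof.
move=> k_bnd; move: s t.
(* Positivity is carried along because division by 0 yields 0, so that average risks decrease only
   from a nonzero count on. *)
pose P (n : T -> nat) := (forall s, (0 < n s)%N) /\
  forall s t, (1 < n s)%N -> L t / (n t)%:R <= L s / (n s).-1%:R.
suff: P (a k) by case.
apply: (greedy_run_ind (P := fun=> P)) k_bnd => [n n1|].
  by split=> [s|s t]; rewrite n1.
move=> {}k n n' s' [n_gt0 n_exch] s'_max n's' n'E.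
have le_nn' s : (n s <= n' s)%N.
  by have [->|/n'E->//] := eqVneq s s'; rewrite n's'.
split=> [s|s t]; first exact: leq_trans (le_nn' s).
have n'_le : L t / (n' t)%:R <= L t / (n t)%:R.
  by apply: ler_div_nat => //; rewrite n_gt0 le_nn'.
have [-> _|/n'E-> n_gt1] := eqVneq s s'.
  (* At the chosen station [(n' s').-1] is the old count [n s'], so the bound is the maximality of
     [s']. *)
  by rewrite n's'; exact: le_trans n'_le (s'_max t).
exact: le_trans n'_le (n_exch _ _ n_gt1).
Qed.

Lemma greedy_optimal (m : T -> nat) : (#|T| <= K)%N ->
    (forall s, (0 < m s)%N) -> (\sum_s m s)%N = K ->
  max_avg_risk L (a K) <= max_avg_risk L m.
Proof.
move=> le_TK m_gt0 m_sum; have K_bnd : (#|T| <= K <= K)%N by rewrite le_TK leqnn.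
have le_max s : L s / (m s)%:R <= max_avg_risk L m by exact: le_bigmax.
(* The default value 0 of the maximum has to be bounded as well. *)
apply: bigmax_le => [|t _]; first exact: bigmax_ge_id.
have [le_mt|lt_mt] := leqP (m t) (a K t).
  by apply: le_trans (le_max t); apply: ler_div_nat => //; rewrite m_gt0.
have [|s lt_ms] := sum_eq_ltn _ lt_mt; first by rewrite greedy_sum.
apply: le_trans (le_max s).
(* From [0 < m s < a K s] it follows that [s] holds at least two units and that
   [m s <= (a K s).-1]. *)
apply: le_trans (greedy_exchange t K_bnd (leq_ltn_trans (m_gt0 s) lt_ms)) _.
by apply: ler_div_nat => //; rewrite m_gt0 -ltnS (ltn_predK lt_ms).
Qed.

End Greedy.

Theorem theorem4p1 (R : realType) (S : {fset R * R}) (W : set (R * R))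
    (C : S -> set (R * R)) (lambda : R * R -> R) (K : nat)
    (a : nat -> S -> nat)
    (S_neq0 : S != fset0)
    (W_neq0 : W !=set0) (W_bounded : bounded_set W) (W_open : open W)
    (C_borel : forall s : S, borel2 (C s))
    (C_partition : partition [set: S] C W)
    (lambda_ge0 : forall u, W u -> 0 <= lambda u)
    (lambda_int : (lebesgue2 R).-integrable W (EFin \o lambda))
    (risk_gt0 : forall s : S, 0 < catchment_risk C lambda s)
    (K_ge : (#|` S| <= K)%N)
    (a_greedy : greedy_run (catchment_risk C lambda) K a) :
  [/\ forall s : S, (1 <= a K s)%N,
      (\sum_(s : S) a K s)%N = K
    & forall m : S -> nat,
        (forall s : S, (1 <= m s)%N) -> (\sum_(s : S) m s)%N = K ->
        max_avg_risk (catchment_risk C lambda) (a K)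
          <= max_avg_risk (catchment_risk C lambda) m].
Proof.
have L_ge0 s : 0 <= catchment_risk C lambda s by exact: ltW.
have le_SK : (#|{: S}| <= K)%N by rewrite -cardfE.
have K_bnd : (#|{: S}| <= K <= K)%N by rewrite le_SK leqnn.
split=> [s||m m_gt0 m_sum].
- exact: (greedy_gt0 a_greedy).
- exact: (greedy_sum a_greedy).
- exact: greedy_optimal.
Qed.
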